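(* Let $G$ be a directed graph with edge weights satisfying the following property: for each vertex $w$, there exists a constant $c_w>0$ such that $w_{uw}=c_w$ for all $u\in N^-(w)$. Then weighted randomized zero forcing on $G$ coincides with unweighted randomized zero forcing on the same underlying directed graph, i.e. for every initial blue set the two processes of blue sets have the same law (the same transition probabilities).
   Context: Weighted randomized zero forcing (RZF): $G$ is a finite directed graph with nonnegative weights $w_{uv}$ on directed edges $(u,v)$, with $w_{uv}=0$ if there is no edge from $u$ to $v$; $N^-(w)$ is the set of in-neighbors of $w$. Start with a blue set $B_0$. Given the blue set $B_t$, each white vertex $w\notin B_t$ independently becomes blue at round $t+1$ with probability $\frac{\sum_{u\in B_t}w_{uw}}{\sum_{u\in V(G)}w_{uw}}$ if the denominator is positive, and $0$ otherwise; blue vertices stay blue forever. Unweighted RZF: the same process, where a white vertex $w$ becomes blue at round $t+1$ with probability $|N^-(w)\cap B_t|/|N^-(w)|$ (and $0$ if $N^-(w)=\varnothing$). *)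

(* Defs.v *)
From HB Require Import structures.
From mathcomp Require Import all_boot all_order all_algebra.
From mathcomp Require Import all_classical all_reals all_analysis.
Set Implicit Arguments.
Unset Strict Implicit.
Unset Printing Implicit Defensive.
Import Order.TTheory GRing.Theory Num.Theory.

Local Open Scope classical_set_scope.
Local Open Scope ring_scope.

Definition in_neighbors (V : finType) (arc : rel V) (v : V) : {set V} :=
  finset (fun u => arc u v).

(* Each vertex pair carries one weight, and pairs that are not arcs have
   weight 0. *)
Definition arc_weights (R : realType) (V : finType) (arc : rel V)
    (weight : V -> V -> R) : Prop :=
  (forall u v, 0 <= weight u v) /\ (forall u v, ~~ arc u v -> weight u v = 0).

(* [weighted_rate weight B v] and [unweighted_rate arc B v] are the
   probabilities that the white vertex [v] turns blue when [B] is the current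
   blue set. *)
Definition weighted_rate (R : realType) (V : finType) (weight : V -> V -> R)
    (B : {set V}) (v : V) : R :=
  if 0 < \sum_u weight u v
  then (\sum_(u in B) weight u v) / \sum_u weight u v
  else 0.

Definition unweighted_rate (R : realType) (V : finType) (arc : rel V)
    (B : {set V}) (v : V) : R :=
  if in_neighbors arc v == finset.set0 then 0
  else #|in_neighbors arc v :&: B|%:R / #|in_neighbors arc v|%:R.

(* One-round transition probability from blue set [B] to blue set [C]: blue
   vertices stay blue, and the white vertices [v] turn blue independently with
   probability [rate B v], whence the product over the complement of [B]. *)
Definition transition (R : realType) (V : finType) (rate : {set V} -> V -> R)
    (B C : {set V}) : R :=
  if B \subset C
  then \prod_(v in ~: B) (if v \in C then rate B v else 1 - rate B v)
  else 0.

Section process.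
Context (R : realType) (V : finType).

Definition history (Omega : Type) (X : nat -> Omega -> {set V})
    (b : nat -> {set V}) (t : nat) : set Omega :=
  [set x | forall s, (s <= t)%N -> X s x = b s].

(* [X] is a random process of blue sets started at [B0] whose conditional law
   at time [t.+1] given the past up to time [t] is [transition rate (X t)].
   The conditional probability is multiplied out, so that histories of
   probability 0 impose nothing. *)
Definition forcing_process (rate : {set V} -> V -> R) (B0 : {set V})
    (d : measure_display) (Omega : measurableType d) (P : probability Omega R)
    (X : nat -> Omega -> {set V}) : Prop :=
  [/\ forall t B, measurable [set x | X t x = B],
      P [set x | X 0%N x = B0] = 1%E
    & forall (t : nat) (b : nat -> {set V}) (C : {set V}),
        P (history X b t `&` [set x | X t.+1 x = C]) =
        (P (history X b t) * (transition rate (b t) C)%:E)%E].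

(* The product sigma-algebra on trajectories, each factor [{set V}] being
   discrete. *)
Definition measurable_trajectories : set (set (nat -> {set V})) :=
  <<s [set A | exists t B, A = [set f | f t = B]] >>.

Definition same_law (d d' : measure_display)
    (Omega : measurableType d) (P : probability Omega R)
    (X : nat -> Omega -> {set V})
    (Omega' : measurableType d') (P' : probability Omega' R)
    (X' : nat -> Omega' -> {set V}) : Prop :=
  forall A, measurable_trajectories A ->
    P [set x | A (X^~ x)] = P' [set x | A (X'^~ x)].

End process.

(* Main.v *)
Require Import Defs.
From HB Require Import structures.
From mathcomp Require Import all_boot all_order all_algebra.
From mathcomp Require Import all_classical all_reals all_analysis.
Set Implicit Arguments.
Unset Strict Implicit.
Unset Printing Implicit Defensive.
Import Order.TTheory GRing.Theory Num.Theory.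
Local Open Scope classical_set_scope.
Local Open Scope ring_scope.

(** The constant in-weight [c_w] cancels between the numerator and the
    denominator of the weighted rate at [w], so the two transition kernels
    agree. The law of the trajectory is determined by the starting set and the
    kernel: these fix the probability of every history up to time [t], hence of
    every event that depends on finitely many rounds, and such events form a
    pi-system generating the product sigma-algebra. *)

(** Split [B] along the in-neighborhood of [v]: vertices outside it have weight 0 towards [v], and
    each of the others contributes [c]. *)
Lemma sum_constant_in_weights (R : realType) (V : finType) (arc : rel V)
    (weight : V -> V -> R) (v : V) (c : R) (B : {set V}) :
  arc_weights arc weight ->
  (forall u, u \in in_neighbors arc v -> weight u v = c) ->
  \sum_(u in B) weight u v = c * #|in_neighbors arc v :&: B|%:R.
Proof.
move=> [_ weight0] weightc.
rewrite (big_setID (in_neighbors arc v)) /= [X in _ + X]big1 ?addr0; last first.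
  by move=> u; rewrite !inE => /andP[Nuv _]; apply: weight0.
rewrite mulr_natr finset.setIC -sumr_const; apply: eq_bigr => u.
by rewrite inE => /andP[/weightc].
Qed.

(** The previous sum, taken over all vertices, makes the denominator [c] times the in-degree. As [c]
    is positive, the denominator vanishes exactly when [v] has no in-neighbor, so both rates take
    their default value 0 in the same case; otherwise [c] cancels. *)
Lemma constant_in_weights_rate (R : realType) (V : finType) (arc : rel V)
    (weight : V -> V -> R) (v : V) (c : R) (B : {set V}) :
  arc_weights arc weight -> 0 < c ->
  (forall u, u \in in_neighbors arc v -> weight u v = c) ->
  weighted_rate weight B v = unweighted_rate R arc B v.
Proof.
move=> w_arc c0 wc; rewrite /weighted_rate /unweighted_rate.
have -> : \sum_u weight u v = c * #|in_neighbors arc v|%:R.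
  rewrite -[in RHS](finset.setIT (in_neighbors arc v)).
  rewrite -(sum_constant_in_weights _ w_arc wc).
  by apply: eq_bigl => u; rewrite finset.in_setT.
rewrite (sum_constant_in_weights _ w_arc wc) pmulr_rgt0// ltr0n card_gt0.
case: eqVneq => //= _.
by rewrite -mulf_div divff ?mul1r// gt_eqF.
Qed.

Section process_law.
Context (R : realType) (V : finType).

Lemma measurable_history (d : measure_display) (Omega : measurableType d)
    (X : nat -> Omega -> {set V}) (b : nat -> {set V}) (t : nat) :
  (forall t B, measurable [set x | X t x = B]) -> measurable (history X b t).
Proof.
move=> mX.
have -> : history X b t = \bigcap_(s in `I_t.+1) [set x | X s x = b s] by [].
by apply: bigcap_measurable; first by exists 0%N.
Qed.

(** Induction on [t]: each further round multiplies the probability by one transition factor. *)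
Lemma probability_history (rate : {set V} -> V -> R) (B0 : {set V})
    (d : measure_display) (Omega : measurableType d) (P : probability Omega R)
    (X : nat -> Omega -> {set V}) (b : nat -> {set V}) (t : nat) :
  forcing_process rate B0 P X ->
  P (history X b t) =
  ((b 0%N == B0)%:R * \prod_(s < t) transition rate (b s) (b s.+1))%:E.
Proof.
move=> [mX X0 XS]; elim: t => [|t IHt].
  have -> : history X b 0 = [set x | X 0%N x = b 0%N].
    by apply/seteqP; split=> x /= xb; [exact: xb|case].
  rewrite big_ord0 mulr1; case: eqVneq => [->//|b0B0].
  (* A start other than [B0] lies in the complement of an event of probability 1. *)
  apply/eqP; rewrite eq_le measure_ge0 andbT.
  have <- : P (~` [set x | X 0%N x = B0]) = (false%:R)%:E.
    by rewrite probability_setC// X0 subee.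
  apply: le_measure; rewrite ?inE//; first exact: measurableC.
  by move=> x /= -> /eqP; rewrite (negbTE b0B0).
have -> : history X b t.+1 = history X b t `&` [set x | X t.+1 x = b t.+1].
  apply/seteqP; split=> [x Xb|x [Xb Xt] s] /=.
    by split=> [s st|]; apply: Xb => //; exact: leqW.
  by rewrite leq_eqVlt => /orP[/eqP->//|]; exact: Xb.
by rewrite XS IHt big_ord_recr/= mulrA EFinM.
Qed.

(** One implication suffices, since [f] and [g] can be exchanged. *)
Definition determined_by (t : nat) (A : set (nat -> {set V})) :=
  forall f g, (forall s, (s <= t)%N -> f s = g s) -> A f -> A g.

(** Histories are indexed by functions on ['I_t.+1] so that the union is finite and distinct indices
    give disjoint events. [inord] extends an index to all rounds; the values it gives after round
    [t] do not affect membership in [A]. *)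
Lemma event_bigcup_history (Omega : Type) (X : nat -> Omega -> {set V})
    (t : nat) (A : set (nat -> {set V})) : determined_by t A ->
  [set x | A (X^~ x)] =
  \bigcup_(b in [set b : {ffun 'I_t.+1 -> {set V}} | A (fun s => b (inord s))])
    history X (fun s => b (inord s)) t.
Proof.
move=> At; apply/seteqP; split=> [x Ax|x [b /= Ab xb]]; last first.
  by apply: At Ab => s st; rewrite xb.
have Xb s : (s <= t)%N -> X s x = [ffun i : 'I_t.+1 => X i x] (inord s).
  by move=> st; rewrite ffunE inordK.
by exists [ffun i : 'I_t.+1 => X i x] => //=; apply: At Ax.
Qed.

Lemma trivIset_history (Omega : Type) (X : nat -> Omega -> {set V})
    (t : nat) (D : set {ffun 'I_t.+1 -> {set V}}) :
  trivIset D (fun b => history X (fun s => b (inord s)) t).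
Proof.
move=> b b' _ _ [x [xb xb']]; apply/ffunP => i.
by have it := ltn_ord i; rewrite -[i]inord_val -xb// -xb'.
Qed.

Lemma measurable_determined_by (d : measure_display) (Omega : measurableType d)
    (X : nat -> Omega -> {set V}) (t : nat) (A : set (nat -> {set V})) :
  (forall t B, measurable [set x | X t x = B]) -> determined_by t A ->
  measurable [set x | A (X^~ x)].
Proof.
move=> mX /event_bigcup_history ->.
by apply: fin_bigcup_measurable => // b _; exact: measurable_history.
Qed.

Lemma determined_by_eq (d d' : measure_display)
    (Omega : measurableType d) (P : probability Omega R)
    (X : nat -> Omega -> {set V})
    (Omega' : measurableType d') (P' : probability Omega' R)
    (X' : nat -> Omega' -> {set V}) (t : nat) (A : set (nat -> {set V})) :
  (forall t B, measurable [set x | X t x = B]) ->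
  (forall t B, measurable [set x | X' t x = B]) ->
  (forall b t, P (history X b t) = P' (history X' b t)) ->
  determined_by t A ->
  P [set x | A (X^~ x)] = P' [set x | A (X'^~ x)].
Proof.
move=> mX mX' PP' At.
rewrite (event_bigcup_history X At) (event_bigcup_history X' At).
set D := [set b | _]; have fD : finite_set D by exact: finite_finset.
have mH b : measurable (history X b t) by exact: measurable_history.
have mH' b : measurable (history X' b t) by exact: measurable_history.
rewrite (measure_fin_bigcup P fD); [|exact: trivIset_history|by []].
rewrite (measure_fin_bigcup P' fD); [|exact: trivIset_history|by []].
by apply: eq_fsbigr => b _; exact: PP'.
Qed.

Lemma same_law_history (d d' : measure_display)
    (Omega : measurableType d) (P : probability Omega R)
    (X : nat -> Omega -> {set V})
    (Omega' : measurableType d') (P' : probability Omega' R)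
    (X' : nat -> Omega' -> {set V}) :
  (forall t B, measurable [set x | X t x = B]) ->
  (forall t B, measurable [set x | X' t x = B]) ->
  (forall b t, P (history X b t) = P' (history X' b t)) ->
  same_law P X P' X'.
Proof.
move=> mX mX' PP'.
pose G := [set A | exists t, determined_by t A].
(* The later of the two horizons determines both events. *)
have GI : setI_closed G.
  move=> A B [t At] [t' Bt]; exists (maxn t t') => f g fg [Af Bf].
  by split; [apply: At Af|apply: Bt Bf] => s st; apply: fg;
    rewrite leq_max st ?orbT.
(* Measurability of both preimages is carried along because the complement and countable union steps
   below rely on it. *)
pose L := [set A | [/\ measurable [set x | A (X^~ x)],
  measurable [set x | A (X'^~ x)] &
  P [set x | A (X^~ x)] = P' [set x | A (X'^~ x)]]].
have dynL : dynkin L.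
  split.
  - by split; [exact: measurableT|exact: measurableT|rewrite !probability_setT].
  - move=> A [mA mA' PA]; split; [exact: measurableC|exact: measurableC|].
    have -> : [set x | (~` A) (X^~ x)] = ~` [set x | A (X^~ x)] by [].
    have -> : [set x | (~` A) (X'^~ x)] = ~` [set x | A (X'^~ x)] by [].
    by rewrite !probability_setC// PA.
  - move=> F tF LF.
    have preU (T : Type) (Y : nat -> T -> {set V}) :
      [set x | (\bigcup_k F k) (Y^~ x)] = \bigcup_k [set x | F k (Y^~ x)] by [].
    have tpre (T : Type) (Y : nat -> T -> {set V}) :
        trivIset setT (fun k => [set x | F k (Y^~ x)]).
      by move=> i j _ _ [x [Fi Fj]]; apply: tF => //; exists (Y^~ x).
    have mF k : measurable [set x | F k (X^~ x)] by case: (LF k).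
    have mF' k : measurable [set x | F k (X'^~ x)] by case: (LF k).
    rewrite /L /= !preU; split; [exact: bigcupT_measurable..|].
    rewrite !measure_bigcup//; apply: eq_eseriesr => k _.
    by case: (LF k).
have GL : G `<=` L.
  move=> A [t At]; split; [exact: measurable_determined_by At..|].
  exact: determined_by_eq At.
move=> A mA; suff [] : L A by [].
(* Each generator of the product sigma-algebra depends on a single round, hence lies in [G]. By the
   pi-lambda theorem [<<s G>>] is the least Dynkin system containing [G], so it is included in
   [L]. *)
have : <<s G >> A.
  apply: (sub_sigma_algebra2 _ mA) => _ [t [B ->]].
  by exists t => f g fg /= <-; rewrite fg.
by rewrite -setI_closed_g_dynkin_g_sigma_algebra//; exact: smallest_sub.
Qed.

End process_law.

Theorem lemma3p2 (R : realType) (V : finType) (arc : rel V)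
    (weight : V -> V -> R)
    (arc_weights_weight : arc_weights arc weight)
    (constant_in_weights : forall w : V, exists c : R,
       0 < c /\ forall u, u \in in_neighbors arc w -> weight u w = c) :
  (forall B C : {set V},
     transition (weighted_rate weight) B C =
     transition (unweighted_rate R arc) B C) /\
  (forall (B0 : {set V})
     (d : measure_display) (Omega : measurableType d)
     (P : probability Omega R) (X : nat -> Omega -> {set V})
     (d' : measure_display) (Omega' : measurableType d')
     (P' : probability Omega' R) (X' : nat -> Omega' -> {set V}),
     forcing_process (weighted_rate weight) B0 P X ->
     forcing_process (unweighted_rate R arc) B0 P' X' ->
     same_law P X P' X').
Proof.
(* Equality of the rates as functions turns both processes into forcing processes for one and the
   same kernel. *)
have rateE : weighted_rate weight = unweighted_rate R arc.
  apply/funext => B; apply/funext => v.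
  have [c [c0 wc]] := constant_in_weights v.
  exact: constant_in_weights_rate wc.
rewrite rateE; split=> // B0 d Omega P X d' Omega' P' X' PX PX'.
have [mX _ _] := PX; have [mX' _ _] := PX'.
apply: same_law_history => // b t.
by rewrite (probability_history _ _ PX) (probability_history _ _ PX').
Qed.
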